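(* Let $K$ be a field with involution. The following conditions are equivalent. (i) The involution on $K$ is positive definite. (ii) The involution on $L_K(E)$ is positive definite for every graph $E$. (iii) The involution on $L_K(E)$ is positive definite for some graph $E$. Thus, if $E$ is an arbitrary graph, $L_K(E)$ is positive definite if and only if $K$ is positive definite.
   Context: Graphs: a (directed) graph $E=(E^0,E^1,r,s)$ consists of two sets $E^0$ (vertices) and $E^1$ (edges), with no restriction on their cardinals, together with maps $r,s:E^1\to E^0$ (range and source). A vertex is a sink if it emits no edges; a vertex $v$ is an infinite emitter if $s^{-1}(v)$ is an infinite set. A path is a finite sequence of edges $\mu=e_1\dots e_n$ with $r(e_i)=s(e_{i+1})$ for $i=1,\dots,n-1$; then $s(\mu)=s(e_1)$, $r(\mu)=r(e_n)$, and $n$ is the length of $\mu$. Vertices are regarded as paths of length $0$. Leavitt path algebra: for a field $K$ and a graph $E$, $L_K(E)$ is the (associative, not necessarily unital) $K$-algebra generated by $E^0\cup E^1\cup\{e^*\mid e\in E^1\}$ with relations: (V) $vw=\delta_{v,w}v$ for all $v,w\in E^0$; (P1) $s(e)e=er(e)=e$ for all $e\in E^1$; (P2) $r(e)e^*=e^*s(e)=e^*$ for all $e\in E^1$; (CK1) $e^*f=\delta_{e,f}r(e)$ for all $e,f\in E^1$; (CK2) $v=\sum_{e\in s^{-1}(v)}ee^*$ for every $v\in E^0$ that is neither a sink nor an infinite emitter. For a path $\mu=e_1\dots e_n$, $\mu^*$ denotes $e_n^*\dots e_1^*$, and $v^*=v$ for vertices $v$; $L_K(E)$ is spanned over $K$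 by the elements $pq^*$ with $p,q$ paths in $E$. Involutions: an involution on a ring $R$ is an additive map $^*:R\to R$ with $(ab)^*=b^*a^*$ and $(a^* )^*=a$ for all $a,b\in R$. For a positive integer $n$, it is $n$-proper if $x_1^*x_1+\dots+x_n^*x_n=0$ implies $x_1=\dots=x_n=0$ for any $x_1,\dots,x_n\in R$. It is positive definite if it is $n$-proper for every positive integer $n$; a ring with a positive definite involution is called positive definite. Given an involution $\overline{\phantom{k}}$ on $K$, the involution on $L_K(E)$ is the one induced from $K$, namely $\left(\sum_i k_ip_iq_i^*\right)^*=\sum_i\overline{k_i}\,q_ip_i^*$ for $k_i\in K$ and paths $p_i,q_i$.
   Formalization: In (iii) and in the final ''Thus'' clause the graph E is required to have at least one vertex, since for the empty graph L_K(E) = 0 is positive definite whatever K is (e.g. K = F_2); (ii) still ranges over every graph. *)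

(* Defs.v *)
From Stdlib Require Import List.
From HB Require Import structures.
From mathcomp Require Import all_boot all_order all_algebra.
From mathcomp Require Import generic_quotient.
From mathcomp Require Import boolp classical_sets functions cardinality.

Set Implicit Arguments.
Unset Strict Implicit.
Unset Printing Implicit Defensive.

Import GRing.Theory.
Local Open Scope ring_scope.
Local Open Scope quotient_scope.

(* Leavitt path algebras need not be unital, so a ring is given here by a
   zmodType R together with an explicit multiplication mul. *)
Section Involutions.
Variables (R : zmodType) (mul : R -> R -> R) (star : R -> R).

Definition is_involution : Prop :=
  [/\ forall a b, star (a + b) = star a + star b,
      forall a b, star (mul a b) = mul (star b) (star a)
    & forall a, star (star a) = a].

Definition n_proper (n : nat) : Prop :=
  forall x : 'I_n -> R,
    \sum_(i < n) mul (star (x i)) (x i) = 0 -> forall i, x i = 0.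

Definition positive_definite : Prop := forall n, (0 < n)%N -> n_proper n.

End Involutions.

Record graph := Graph {
  vertex : Type;
  edge : Type;
  range : edge -> vertex;
  source : edge -> vertex }.

Section GraphTheory.
Variable E : graph.

Definition is_sink (v : vertex E) : Prop := forall e : edge E, source e <> v.

Definition is_infinite_emitter (v : vertex E) : Prop :=
  infinite_set [set e : edge E | source e = v]%classic.

Fixpoint composable (e : edge E) (p : seq (edge E)) : Prop :=
  if p is f :: p' then range e = source f /\ composable f p' else True.

Inductive gpath :=
| Vertex of vertex E
| Edges e p of composable e p.

End GraphTheory.

(* L_K(E) is presented by generators and relations: it is the quotient of the
   formal expressions in the generators by the least congruence that contains
   the axioms of (not necessarily unital) associative K-algebras and the
   relations (V), (P1), (P2), (CK1), (CK2). *)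
Section Presentation.
Variables (K : fieldType) (E : graph).

Inductive term :=
| TVertex of vertex E
| TEdge of edge E
| TGhost of edge E
| TZero
| TAdd of term & term
| TScale of K & term
| TMul of term & term.

Definition tsum (ts : seq term) : term := foldr TAdd TZero ts.

Inductive lpa_cong : term -> term -> Prop :=
| cong_refl x : lpa_cong x x
| cong_sym x y : lpa_cong x y -> lpa_cong y x
| cong_trans x y z : lpa_cong x y -> lpa_cong y z -> lpa_cong x z
| cong_add x x' y y' :
    lpa_cong x x' -> lpa_cong y y' -> lpa_cong (TAdd x y) (TAdd x' y')
| cong_scale k x x' : lpa_cong x x' -> lpa_cong (TScale k x) (TScale k x')
| cong_mul x x' y y' :
    lpa_cong x x' -> lpa_cong y y' -> lpa_cong (TMul x y) (TMul x' y')
| cong_addA x y z : lpa_cong (TAdd x (TAdd y z)) (TAdd (TAdd x y) z)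
| cong_addC x y : lpa_cong (TAdd x y) (TAdd y x)
| cong_add0 x : lpa_cong (TAdd TZero x) x
| cong_addN x : lpa_cong (TAdd (TScale (-1) x) x) TZero
| cong_scaleA a b x : lpa_cong (TScale a (TScale b x)) (TScale (a * b) x)
| cong_scale1 x : lpa_cong (TScale 1 x) x
| cong_scaleDr a x y :
    lpa_cong (TScale a (TAdd x y)) (TAdd (TScale a x) (TScale a y))
| cong_scaleDl a b x :
    lpa_cong (TScale (a + b) x) (TAdd (TScale a x) (TScale b x))
| cong_mulA x y z : lpa_cong (TMul x (TMul y z)) (TMul (TMul x y) z)
| cong_mulDl x y z : lpa_cong (TMul (TAdd x y) z) (TAdd (TMul x z) (TMul y z))
| cong_mulDr x y z : lpa_cong (TMul x (TAdd y z)) (TAdd (TMul x y) (TMul x z))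
| cong_scaleAl a x y : lpa_cong (TMul (TScale a x) y) (TScale a (TMul x y))
| cong_scaleAr a x y : lpa_cong (TMul x (TScale a y)) (TScale a (TMul x y))
| cong_V_same v : lpa_cong (TMul (TVertex v) (TVertex v)) (TVertex v)
| cong_V_diff v w : v <> w -> lpa_cong (TMul (TVertex v) (TVertex w)) TZero
| cong_P1_source e : lpa_cong (TMul (TVertex (source e)) (TEdge e)) (TEdge e)
| cong_P1_range e : lpa_cong (TMul (TEdge e) (TVertex (range e))) (TEdge e)
| cong_P2_range e : lpa_cong (TMul (TVertex (range e)) (TGhost e)) (TGhost e)
| cong_P2_source e : lpa_cong (TMul (TGhost e) (TVertex (source e))) (TGhost e)
| cong_CK1_same e : lpa_cong (TMul (TGhost e) (TEdge e)) (TVertex (range e))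
| cong_CK1_diff e f : e <> f -> lpa_cong (TMul (TGhost e) (TEdge f)) TZero
(* es enumerates the edges emitted by v *)
| cong_CK2 v es :
    ~ is_sink v -> ~ is_infinite_emitter v ->
    NoDup es -> (forall e, In e es <-> source e = v) ->
    lpa_cong (TVertex v) (tsum [seq TMul (TEdge e) (TGhost e) | e <- es]).

HB.instance Definition _ := gen_eqMixin term.
HB.instance Definition _ := gen_choiceMixin term.

Definition lpa_congb : rel term := fun x y => `[< lpa_cong x y >].

Lemma lpa_congb_refl : reflexive lpa_congb.
Proof. by move=> x; apply/asboolP/cong_refl. Qed.

Lemma lpa_congb_sym : symmetric lpa_congb.
Proof. by move=> x y; apply/asboolP/asboolP => /cong_sym. Qed.

Lemma lpa_congb_trans : transitive lpa_congb.
Proof.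
by move=> y x z /asboolP xy /asboolP yz; apply/asboolP/(cong_trans xy yz).
Qed.

Canonical lpa_equiv :=
  EquivRel lpa_congb lpa_congb_refl lpa_congb_sym lpa_congb_trans.

Definition lpa := {eq_quot lpa_equiv}.

HB.instance Definition _ := Choice.on lpa.
HB.instance Definition _ := EqQuotient.on lpa.

Definition lpa_class (t : term) : lpa := \pi_lpa t.

Lemma lpa_classP (x y : term) : lpa_class x = lpa_class y <-> lpa_cong x y.
Proof.
split; first by move/eqP; rewrite /lpa_class piE => /asboolP.
by move=> xy; apply/eqP; rewrite /lpa_class piE; apply/asboolP.
Qed.

Lemma lpa_classK (x : lpa) : lpa_class (repr x) = x.
Proof. exact: reprK. Qed.

Lemma repr_class (t : term) : lpa_cong (repr (lpa_class t)) t.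
Proof. by apply/lpa_classP; rewrite lpa_classK. Qed.

Lemma lpa_ind (P : lpa -> Prop) : (forall t, P (lpa_class t)) -> forall x, P x.
Proof. by move=> Pc x; rewrite -(lpa_classK x). Qed.

Definition lpa_zero : lpa := lpa_class TZero.
Definition lpa_add (x y : lpa) : lpa := lpa_class (TAdd (repr x) (repr y)).
Definition lpa_opp (x : lpa) : lpa := lpa_class (TScale (-1) (repr x)).
Definition lpa_scale (k : K) (x : lpa) : lpa := lpa_class (TScale k (repr x)).
Definition lpa_mul (x y : lpa) : lpa := lpa_class (TMul (repr x) (repr y)).

Lemma lpa_addE s t :
  lpa_add (lpa_class s) (lpa_class t) = lpa_class (TAdd s t).
Proof. by apply/lpa_classP/cong_add; apply: repr_class. Qed.

Lemma lpa_oppE t : lpa_opp (lpa_class t) = lpa_class (TScale (-1) t).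
Proof. by apply/lpa_classP/cong_scale/repr_class. Qed.

Lemma lpa_scaleE k t : lpa_scale k (lpa_class t) = lpa_class (TScale k t).
Proof. by apply/lpa_classP/cong_scale/repr_class. Qed.

Lemma lpa_mulE s t :
  lpa_mul (lpa_class s) (lpa_class t) = lpa_class (TMul s t).
Proof. by apply/lpa_classP/cong_mul; apply: repr_class. Qed.

Fact lpa_addA : associative lpa_add.
Proof.
elim/lpa_ind=> x; elim/lpa_ind=> y; elim/lpa_ind=> z.
by rewrite !lpa_addE; apply/lpa_classP/cong_addA.
Qed.

Fact lpa_addC : commutative lpa_add.
Proof.
elim/lpa_ind=> x; elim/lpa_ind=> y.
by rewrite !lpa_addE; apply/lpa_classP/cong_addC.
Qed.

Fact lpa_add0 : left_id lpa_zero lpa_add.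
Proof. by elim/lpa_ind=> x; rewrite lpa_addE; apply/lpa_classP/cong_add0. Qed.

Fact lpa_addN : left_inverse lpa_zero lpa_opp lpa_add.
Proof.
by elim/lpa_ind=> x; rewrite lpa_oppE lpa_addE; apply/lpa_classP/cong_addN.
Qed.

HB.instance Definition _ :=
  GRing.isZmodule.Build lpa lpa_addA lpa_addC lpa_add0 lpa_addN.

Fact lpa_scaleA a b x : lpa_scale a (lpa_scale b x) = lpa_scale (a * b) x.
Proof.
by elim/lpa_ind: x => x; rewrite !lpa_scaleE; apply/lpa_classP/cong_scaleA.
Qed.

Fact lpa_scale1 : left_id 1 lpa_scale.
Proof.
by elim/lpa_ind=> x; rewrite lpa_scaleE; apply/lpa_classP/cong_scale1.
Qed.

Fact lpa_scaleDr : right_distributive lpa_scale +%R.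
Proof.
move=> a; elim/lpa_ind=> x; elim/lpa_ind=> y.
rewrite /GRing.add /= !(lpa_scaleE, lpa_addE).
exact/lpa_classP/cong_scaleDr.
Qed.

Fact lpa_scaleDl x : {morph lpa_scale^~ x : a b / a + b}.
Proof.
elim/lpa_ind: x => x a b; rewrite [RHS]/GRing.add /= !(lpa_scaleE, lpa_addE).
exact/lpa_classP/cong_scaleDl.
Qed.

HB.instance Definition _ := GRing.Zmodule_isLmodule.Build K lpa
  lpa_scaleA lpa_scale1 lpa_scaleDr lpa_scaleDl.

Lemma lpa_class0 : lpa_class TZero = 0.
Proof. by []. Qed.

Lemma lpa_classD s t : lpa_class (TAdd s t) = lpa_class s + lpa_class t.
Proof. by rewrite -lpa_addE. Qed.

Lemma lpa_classZ k t : lpa_class (TScale k t) = k *: lpa_class t.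
Proof. by rewrite -lpa_scaleE. Qed.

Lemma lpa_classM s t :
  lpa_class (TMul s t) = lpa_mul (lpa_class s) (lpa_class t).
Proof. by rewrite lpa_mulE. Qed.

Lemma lpa_mulA : associative lpa_mul.
Proof.
elim/lpa_ind=> x; elim/lpa_ind=> y; elim/lpa_ind=> z.
by rewrite -!lpa_classM; apply/lpa_classP/cong_mulA.
Qed.

Lemma lpa_mulDl : left_distributive lpa_mul +%R.
Proof.
elim/lpa_ind=> x; elim/lpa_ind=> y; elim/lpa_ind=> z.
by rewrite -lpa_classD -!lpa_classM -lpa_classD; apply/lpa_classP/cong_mulDl.
Qed.

Lemma lpa_mulDr : right_distributive lpa_mul +%R.
Proof.
elim/lpa_ind=> x; elim/lpa_ind=> y; elim/lpa_ind=> z.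
by rewrite -lpa_classD -!lpa_classM -lpa_classD; apply/lpa_classP/cong_mulDr.
Qed.

Lemma lpa_scalerAl a (x y : lpa) : lpa_mul (a *: x) y = a *: lpa_mul x y.
Proof.
elim/lpa_ind: x => x; elim/lpa_ind: y => y.
by rewrite -lpa_classZ -!lpa_classM -lpa_classZ; apply/lpa_classP/cong_scaleAl.
Qed.

Lemma lpa_scalerAr a (x y : lpa) : lpa_mul x (a *: y) = a *: lpa_mul x y.
Proof.
elim/lpa_ind: x => x; elim/lpa_ind: y => y.
by rewrite -lpa_classZ -!lpa_classM -lpa_classZ; apply/lpa_classP/cong_scaleAr.
Qed.

Definition lpa_vertex (v : vertex E) : lpa := lpa_class (TVertex v).
Definition lpa_edge (e : edge E) : lpa := lpa_class (TEdge e).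
Definition lpa_ghost (e : edge E) : lpa := lpa_class (TGhost e).

Fixpoint lpa_edges (e : edge E) (p : seq (edge E)) : lpa :=
  if p is f :: p' then lpa_mul (lpa_edge e) (lpa_edges f p') else lpa_edge e.

Fixpoint lpa_ghosts (e : edge E) (p : seq (edge E)) : lpa :=
  if p is f :: p' then lpa_mul (lpa_ghosts f p') (lpa_ghost e)
  else lpa_ghost e.

Definition lpa_path (p : gpath E) : lpa :=
  match p with Vertex v => lpa_vertex v | @Edges _ e p _ => lpa_edges e p end.

Definition lpa_ghost_path (p : gpath E) : lpa :=
  match p with Vertex v => lpa_vertex v | @Edges _ e p _ => lpa_ghosts e p end.

End Presentation.

Section InducedInvolution.
Variables (K : fieldType) (E : graph) (conj : K -> K).

Fixpoint term_star (t : term K E) : term K E :=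
  match t with
  | TVertex v => TVertex K v
  | TEdge e => TGhost K e
  | TGhost e => TEdge K e
  | TZero => TZero K E
  | TAdd x y => TAdd (term_star x) (term_star y)
  | TScale k x => TScale (conj k) (term_star x)
  | TMul x y => TMul (term_star y) (term_star x)
  end.

(* Compatible with the congruence when conj is an involution, see
   lpa_star_class; lpa_starE is its usual formula. *)
Definition lpa_star (x : lpa K E) : lpa K E := lpa_class (term_star (repr x)).

Hypothesis conj_inv : is_involution *%R conj.

Let conjD a b : conj (a + b) = conj a + conj b.
Proof. by case: conj_inv. Qed.

Let conjM a b : conj (a * b) = conj a * conj b.
Proof. by case: conj_inv => _ -> _; rewrite mulrC. Qed.

Let conjK a : conj (conj a) = a.
Proof. by case: conj_inv. Qed.

Let conj1 : conj 1 = 1.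
Proof. by have := conjM (conj 1) 1; rewrite mulr1 conjK mul1r. Qed.

Let conjN1 : conj (-1) = -1.
Proof.
have c0 : conj 0 = 0 by apply: (addIr (conj 0)); rewrite -conjD !add0r.
by apply: (addIr 1); rewrite addNr -c0 -(addNr 1) conjD conj1.
Qed.

Lemma term_star_cong (s t : term K E) :
  lpa_cong s t -> lpa_cong (term_star s) (term_star t).
Proof.
elim=> {s t} /=.
- by move=> x; apply: cong_refl.
- by move=> x y _; apply: cong_sym.
- by move=> x y z _ xy _; apply: cong_trans.
- by move=> x x' y y' _ xx' _; apply: cong_add.
- by move=> k x x' _; apply: cong_scale.
- by move=> x x' y y' _ xx' _ yy'; apply: cong_mul.
- by move=> x y z; apply: cong_addA.
- by move=> x y; apply: cong_addC.
- by move=> x; apply: cong_add0.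
- by move=> x; rewrite conjN1; apply: cong_addN.
- by move=> a b x; rewrite conjM; apply: cong_scaleA.
- by move=> x; rewrite conj1; apply: cong_scale1.
- by move=> a x y; apply: cong_scaleDr.
- by move=> a b x; rewrite conjD; apply: cong_scaleDl.
- by move=> x y z; apply/cong_sym/cong_mulA.
- by move=> x y z; apply: cong_mulDr.
- by move=> x y z; apply: cong_mulDl.
- by move=> a x y; apply: cong_scaleAr.
- by move=> a x y; apply: cong_scaleAl.
- by move=> v; apply: cong_V_same.
- by move=> v w vw; apply: cong_V_diff => wv; apply: vw.
- by move=> e; apply: cong_P2_source.
- by move=> e; apply: cong_P2_range.
- by move=> e; apply: cong_P1_range.
- by move=> e; apply: cong_P1_source.
- by move=> e; apply: cong_CK1_same.
- by move=> e f ef; apply: cong_CK1_diff => fe; apply: ef.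
- move=> v es nsink ninf uniq_es esP.
  have -> : term_star (tsum [seq TMul (TEdge K e) (TGhost K e) | e <- es])
          = tsum [seq TMul (TEdge K e) (TGhost K e) | e <- es].
    by elim: es {uniq_es esP} => //= e es ->.
  exact: cong_CK2.
Qed.

Lemma lpa_star_class (t : term K E) :
  lpa_star (lpa_class t) = lpa_class (term_star t).
Proof. exact/lpa_classP/term_star_cong/repr_class. Qed.

Lemma lpa_star_involution : is_involution (@lpa_mul K E) lpa_star.
Proof.
split.
- elim/lpa_ind=> x; elim/lpa_ind=> y.
  by rewrite -lpa_classD !lpa_star_class -lpa_classD.
- elim/lpa_ind=> x; elim/lpa_ind=> y.
  by rewrite -lpa_classM !lpa_star_class -lpa_classM.
elim/lpa_ind=> x; rewrite !lpa_star_class; congr lpa_class.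
by elim: x => //= [x -> y ->|k x ->|x -> y ->] //; rewrite conjK.
Qed.

Lemma lpa_star_path (p : gpath E) :
  lpa_star (lpa_path K p) = lpa_ghost_path K p.
Proof.
case: lpa_star_involution => _ starM _.
case: p => [v|e p _] /=; first exact: lpa_star_class.
elim: p e => [|f p IHp] e /=; first exact: lpa_star_class.
by rewrite starM IHp; congr lpa_mul; apply: lpa_star_class.
Qed.

Lemma lpa_starE (n : nat) (k : 'I_n -> K) (p q : 'I_n -> gpath E) :
  lpa_star
    (\sum_(i < n) k i *: lpa_mul (lpa_path K (p i)) (lpa_ghost_path K (q i)))
  = \sum_(i < n)
      conj (k i) *: lpa_mul (lpa_path K (q i)) (lpa_ghost_path K (p i)).
Proof.
case: lpa_star_involution => starD starM starK.
have star0 : lpa_star 0 = 0 by exact: lpa_star_class.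
rewrite (big_morph _ starD star0); apply: eq_bigr => i _.
have starZ c x : lpa_star (c *: x) = conj c *: lpa_star x.
  elim/lpa_ind: x => x.
  by rewrite -lpa_classZ !lpa_star_class -lpa_classZ.
by rewrite starZ starM lpa_star_path -lpa_star_path starK.
Qed.

End InducedInvolution.

(* Main.v *)
(* L_K(E) acts on the functions on the points of a graded branching system so
   that the adjoint of a is a^*. If sum_i a_i^* a_i = 0, the diagonal matrix
   coefficients of this sum express, for each point x, that the sum of
   conj(k) k over the coefficients k in the columns at x of all the a_i is
   zero; hence all a_i act as 0 when K is positive definite. The action is
   faithful: by (CK2) every element is a combination of monomials p q^* with
   |q| = N, or |q| < N and r(q) singular, and the matrix coefficients recover
   the coefficients of such a combination. The grading is what makes this work
   for cycles without exits. Conversely, vertices act as nonzero projections, so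
   K positive definite follows from restricting to the multiples of a vertex. *)

From Stdlib Require Import List.
From HB Require Import structures.
From mathcomp Require Import all_boot all_order all_algebra.
From mathcomp Require Import boolp classical_sets cardinality.
Require Import Defs.

Set Implicit Arguments.
Unset Strict Implicit.
Unset Printing Implicit Defensive.

Import GRing.Theory.
Local Open Scope ring_scope.

(** * Regular vertices and branching systems *)

HB.instance Definition _ (E : graph) := gen_eqMixin (vertex E).
HB.instance Definition _ (E : graph) := gen_choiceMixin (vertex E).
HB.instance Definition _ (E : graph) := gen_eqMixin (edge E).
HB.instance Definition _ (E : graph) := gen_choiceMixin (edge E).

(** The vertices at which (CK2) is imposed; the others are called singular. *)
Definition regular (E : graph) (v : vertex E) : Prop :=
  ~ is_sink v /\ ~ is_infinite_emitter v.

Lemma In_mem (T : eqType) (x : T) (s : seq T) : In x s <-> x \in s.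
Proof.
elim: s => //= y s IHs; rewrite inE; split.
  by case=> [->|/IHs ->]; rewrite ?eqxx ?orbT.
by case/predU1P => [->|/IHs]; [left | right].
Qed.

Lemma NoDup_uniq (T : eqType) (s : seq T) : NoDup s <-> uniq s.
Proof.
split; first by elim=> //= x t xt _ ->; rewrite andbT; apply/negP => /In_mem.
elim: s => [|x s IHs] /=; first by constructor.
by case/andP=> xs /IHs us; constructor => // /In_mem; apply/negP.
Qed.

(** A list of the emitted edges is the form in which regularity is used: it numbers the edges in
    [branching_exists] and indexes the sum in (CK2). *)
Lemma regularP (E : graph) (v : vertex E) :
  regular v <-> exists es : seq (edge E),
    [/\ uniq es, es != [::] & forall e, e \in es = (source e == v)].
Proof.
split=> [[nsink ninf]|[es [ues es0 esP]]].
  have /finite_seqP[es esE] :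
      finite_set [set e : edge E | source e = v]%classic.
    by apply: contrapT.
  have esP e : e \in undup es = (source e == v).
    rewrite mem_undup; apply/idP/eqP => [e_es|ev].
      by have : [set` es]%classic e by []; rewrite -esE.
    by have : [set e : edge E | source e = v]%classic e by []; rewrite esE.
  exists (undup es); split=> //; first exact: undup_uniq.
  apply/eqP => es0; apply: nsink => e /eqP; rewrite -esP es0.
  by [].
split.
  case: es es0 esP {ues} => // e es _ /(_ e); rewrite mem_head => /esym/eqP ev.
  by move=> /(_ e).
apply; apply/finite_seqP; exists es; apply/seteqP; split=> e /=.
  by move/eqP; rewrite -esP.
by rewrite esP => /eqP.
Qed.

(* A graded branching system: each edge e embeds the points over its range
   into the points over its source, shifting the degree by one; the images are
   disjoint, and they cover the points over a vertex exactly when it is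
   regular. *)
Record branching (E : graph) := Branching {
  point : eqType;
  base : point -> vertex E;
  degree : point -> int;
  push : edge E -> point -> point;
  pop : point -> option (edge E * point);
  pop_push : forall e y, base y = range e -> pop (push e y) = Some (e, y);
  popE : forall x e y, pop x = Some (e, y) ->
    [/\ base x = source e, base y = range e & push e y = x];
  degree_push : forall e y, degree (push e y) = degree y + 1;
  pop_regular : forall x, regular (base x) -> pop x <> None;
  point_over : forall v, exists x, base x = v;
  point_singular : forall v, ~ regular v ->
    exists2 x, base x = v & pop x = None }.

(* Points are (v, (m, l), d) with m a number, l a list of edges and d the
   degree. Over a regular vertex emitting n edges, m is split into its residue
   mod n, which names an edge, and its quotient. Over a singular vertex, edges
   are consed onto l, so that the points with l empty are not hit. *)
Lemma branching_exists (E : graph) : inhabited (branching E).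
Proof.
(* Singular vertices get the empty list, so that emptiness of [es v] decides regularity in [push]
   and [pop]. *)
have /choice[es esP] (v : vertex E) : exists s : seq (edge E),
    [/\ uniq s, s != [::] <-> regular v,
        s != [::] -> forall e, e \in s = (source e == v)
      & forall e, e \in s -> source e = v].
  have [/[dup] rv /regularP[s [us s0 sP]]|nrv] := pselect (regular v).
    by exists s; split=> // e; rewrite sP => /eqP.
  by exists [::].
pose X : eqType := (vertex E * (nat * seq (edge E)) * int)%type.
pose push e (x : X) : X := let: (_, (m, l), d) := x in
  let s := es (source e) in
  (source e,
   (if s == [::] then (m, e :: l) else (m * size s + index e s, l)%N), d + 1).
pose pop (x : X) : option (edge E * X) := let: (v, (m, l), d) := x in
  let s := es v in
  if s is e0 :: _ then
    let e := nth e0 s (m %% size s) in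
    Some (e, (range e, (m %/ size s, l)%N, d - 1))
  else if l is e :: l' then
    if source e == v then Some (e, (range e, (m, l'), d - 1)) else None
  else None.
have sizeP (v : vertex E) : es v != [::] -> (0 < size (es v))%N.
  by rewrite lt0n size_eq0.
constructor.
refine (@Branching E X (fun x => x.1.1) (fun x => x.2) push pop _ _ _ _ _ _).
- move=> e [[v [m l]] d] /= ->; rewrite /pop /push.
  case: (esP (source e)) => ues _ inE _.
  case: (altP (es (source e) =P [::])) => [->|s0]; first by rewrite eqxx addrK.
  have e_s : e \in es (source e) by rewrite inE.
  case Es: (es (source e)) s0 e_s ues => [//|e0 s] _ e_s ues.
  rewrite -Es in e_s ues *.
  rewrite modnMDl divnMDl ?sizeP ?Es // -Es modn_small ?index_mem //.
  by rewrite divn_small ?index_mem // addn0 nth_index // addrK.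
- move=> [[v [m l]] d] e y; rewrite /pop /push.
  case: (esP v) => ues _ inE sE.
  case Es: (es v) => [|e0 s].
    case: l => // f l; case: eqP => // fv [<- <-] /=.
    by rewrite fv Es eqxx subrK.
  rewrite -Es => -[<- <-] /=.
  have s0 : es v != [::] by rewrite Es.
  have e_s : nth e0 (es v) (m %% size (es v)) \in es v.
    by rewrite mem_nth // ltn_mod sizeP.
  rewrite (sE _ e_s) (negPf s0) subrK index_uniq ?ltn_mod ?sizeP //.
  by rewrite -divn_eq.
- by move=> e [[v [m l]] d].
- move=> [[v [m l]] d] /=; rewrite /pop; case: (esP v) => _ <- _ _.
  by case: (es v).
- by move=> v; exists (v, (0%N, [::]), 0).
- move=> v nrv; exists (v, (0%N, [::]), 0) => //=; rewrite /pop.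
  case: (esP v) => _ rv _ _; case Es: (es v) => [//|e0 s].
  by case: nrv; apply/rv; rewrite Es.
Qed.

(** * Action on a branching system *)

Section Representation.
Variables (K : fieldType) (E : graph) (B : branching E).
Notation X := (point B).
Notation pop := (@pop E B).
Notation push := (@push E B).
Implicit Types (s t : term K E) (phi psi : X -> K) (x y z : X).

(** An edge [e] carries the point mass at [y] to the one at [push e y] if [y] lies over [range e],
    and to 0 otherwise; its ghost goes back. Allowing all functions avoids carrying finite supports
    along. *)
Fixpoint act t phi x : K :=
  match t with
  | TVertex v => if base x == v then phi x else 0
  | TEdge e =>
      if pop x is Some (f, y) then if f == e then phi y else 0 else 0
  | TGhost e => if base x == range e then phi (push e x) else 0
  | TZero => 0
  | TAdd s t => act s phi x + act t phi x
  | TScale k t => k * act t phi x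
  | TMul s t => act s (act t phi) x
  end.

Lemma base_push e y : base y = range e -> base (push e y) = source e.
Proof. by move/pop_push/popE => [->]. Qed.

(** Linearity serves the congruence axioms in which a left factor meets a sum or a multiple. *)
Lemma act_lin t k phi psi x :
  act t (fun y => k * phi y + psi y) x = k * act t phi x + act t psi x.
Proof.
elim: t phi psi x => [v|e|e||s IHs t IHt|c t IHt|s IHs t IHt] phi psi x /=.
- by case: ifP; rewrite ?mulr0 ?addr0.
- by case: (pop x) => [[f y]|]; [case: ifP|]; rewrite ?mulr0 ?addr0.
- by case: ifP; rewrite ?mulr0 ?addr0.
- by rewrite mulr0 addr0.
- by rewrite IHs IHt mulrDr addrACA.
- by rewrite IHt mulrDr !mulrA (mulrC c).
- by rewrite -IHs; congr act; apply/funext => y; rewrite IHt.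
Qed.

Lemma act0 t x : act t (fun=> 0) x = 0.
Proof.
have := act_lin t 1 (fun=> 0) (fun=> 0) x.
by rewrite !mul1r addr0 -[LHS]addr0 => /addrI.
Qed.

Lemma actD t phi psi x :
  act t (fun y => phi y + psi y) x = act t phi x + act t psi x.
Proof.
rewrite -[act t phi x]mul1r -act_lin; congr act.
by apply/funext => y; rewrite mul1r.
Qed.

Lemma actZ t k phi x : act t (fun y => k * phi y) x = k * act t phi x.
Proof.
rewrite -[RHS]addr0 -(act0 t x) -act_lin; congr act.
by apply/funext => y; rewrite addr0.
Qed.

Lemma act_sum t (I : Type) (r : seq I) (F : I -> X -> K) x :
  act t (fun y => \sum_(i <- r) F i y) x = \sum_(i <- r) act t (F i) x.
Proof.
elim: r => [|i r IHr].
  by rewrite big_nil -[RHS](act0 t x); congr act; apply/funext => y;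
     rewrite big_nil.
rewrite big_cons -IHr -actD; congr act; apply/funext => y.
by rewrite big_cons.
Qed.

Lemma act_tsum (ts : seq (term K E)) phi x :
  act (tsum ts) phi x = \sum_(t <- ts) act t phi x.
Proof. by elim: ts => [|t ts IHts]; rewrite (big_nil, big_cons) //= IHts. Qed.

(** The relations mirror the axioms of a branching system: [popE] gives (P1), [pop_push] gives
    (CK1), and [pop_regular] together with [popE] gives (CK2). *)
Lemma act_cong s t : lpa_cong s t -> act s = act t.
Proof.
elim=> {s t}; try by move=> *; do 2!apply/funext => ?; rewrite /= ?actD ?actZ.
- by move=> x y _ ->.
- by move=> x y z _ -> _ ->.
- by move=> x x' y y' _ + _ + => /= -> ->.
- by move=> k x x' _ /= ->.
- by move=> x x' y y' _ + _ + => /= -> ->.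
- by move=> x y z; do 2!apply/funext => ?; rewrite /= addrA.
- by move=> x y; do 2!apply/funext => ?; rewrite /= addrC.
- by move=> x; do 2!apply/funext => ?; rewrite /= add0r.
- by move=> x; do 2!apply/funext => ?; rewrite /= mulN1r addNr.
- by move=> a b x; do 2!apply/funext => ?; rewrite /= mulrA.
- by move=> x; do 2!apply/funext => ?; rewrite /= mul1r.
- by move=> a x y; do 2!apply/funext => ?; rewrite /= mulrDr.
- by move=> a b x; do 2!apply/funext => ?; rewrite /= mulrDl.
- by move=> v; do 2!apply/funext => ? /=; case: eqP.
- move=> v w vw; apply/funext => phi; apply/funext => x /=.
  by case: eqP => // ->; case: eqP.
- move=> e; apply/funext => phi; apply/funext => x /=.
  case px: (pop x) => [[f y]|]; last by case: ifP.
  by have [-> _ _] := popE px;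
    case: (altP (f =P e)) => [->|]; rewrite ?eqxx ?if_same.
- move=> e; apply/funext => phi; apply/funext => x /=.
  case px: (pop x) => [[f y]|] //.
  by have [_ -> _] := popE px;
    case: (altP (f =P e)) => [->|]; rewrite ?eqxx ?if_same.
- by move=> e; do 2!apply/funext => ? /=; case: eqP.
- move=> e; apply/funext => phi; apply/funext => x /=.
  by case: eqP => // /base_push ->; rewrite eqxx.
- move=> e; apply/funext => phi; apply/funext => x /=.
  by case: eqP => // /pop_push ->; rewrite eqxx.
- move=> e f ef; apply/funext => phi; apply/funext => x /=.
  by case: eqP => // /pop_push ->; case: eqP.
move=> v es nsink ninf /NoDup_uniq ues esP.
apply/funext => phi; apply/funext => x; rewrite act_tsum big_map /=.
(* Over [v], the point [x] pops to exactly one edge, whose summand is [phi x]; elsewhere no edge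
   emitted by [v] can be popped. *)
have [xv|xv] := eqVneq.
  case px: (pop x) => [[f y]|]; last by case: (@pop_regular _ _ x); rewrite ?xv.
  have [xf yf fy] := popE px.
  rewrite (bigD1_seq f) //=; last by apply/In_mem/esP; rewrite -xf.
  rewrite eqxx yf eqxx fy big1 ?addr0 // => e ef.
  by rewrite eq_sym (negPf ef).
rewrite big1_seq // => e /= /In_mem/esP ev.
case px: (pop x) => [[f y]|] //; case: eqP => // fe.
by have [xf _ _] := popE px; rewrite xf fe ev eqxx in xv.
Qed.

Definition rep (a : lpa K E) : (X -> K) -> X -> K := act (repr a).

Lemma rep_class t : rep (lpa_class t) = act t.
Proof. exact/act_cong/repr_class. Qed.

Lemma repD (a b : lpa K E) phi x :
  rep (a + b) phi x = rep a phi x + rep b phi x.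
Proof.
by elim/lpa_ind: a => s; elim/lpa_ind: b => t; rewrite -lpa_classD !rep_class.
Qed.

Lemma rep0 phi x : rep 0 phi x = 0.
Proof. by rewrite -lpa_class0 rep_class. Qed.

Lemma repZ k (a : lpa K E) phi x : rep (k *: a) phi x = k * rep a phi x.
Proof. by elim/lpa_ind: a => t; rewrite -lpa_classZ !rep_class. Qed.

Lemma repM (a b : lpa K E) phi x :
  rep (lpa_mul a b) phi x = rep a (rep b phi) x.
Proof.
by elim/lpa_ind: a => s; elim/lpa_ind: b => t; rewrite -lpa_classM !rep_class.
Qed.

Lemma rep_sum (I : Type) (r : seq I) (F : I -> lpa K E) phi x :
  rep (\sum_(i <- r) F i) phi x = \sum_(i <- r) rep (F i) phi x.
Proof.
elim: r => [|i r IHr]; first by rewrite !big_nil rep0.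
by rewrite !big_cons repD IHr.
Qed.

(** * Matrix entries with respect to point masses *)

Definition delta x : X -> K := fun y => if y == x then 1 else 0.

Lemma fun_delta (S : seq X) phi : uniq S -> (forall y, phi y != 0 -> y \in S) ->
  phi = fun y => \sum_(x <- S) phi x * delta x y.
Proof.
move=> uS phiS; apply/funext => y; rewrite /delta.
under eq_bigr do rewrite (fun_if ( *%R _)) mulr1 mulr0 eq_sym.
have [yS|yS] := boolP (y \in S).
  by rewrite (bigD1_seq y) //= eqxx big1 ?addr0 // => x /negPf ->.
rewrite big1_seq; last first.
  by move=> x /= xS; case: eqP => // xy; rewrite -xy xS in yS.
by apply/eqP/negP => /negP /phiS; apply/negP.
Qed.

(** Edges move a support forward by [push], ghosts move it back by [pop]. Hence the columns of the
    matrix of a term are finite, as matrix products require. *)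
Lemma act_finite t phi (S : seq X) : (forall y, phi y != 0 -> y \in S) ->
  exists S' : seq X, forall y, act t phi y != 0 -> y \in S'.
Proof.
elim: t phi S => [v|e|e||s IHs t IHt|c t IHt|s IHs t IHt] phi S phiS /=.
- by exists S => y; case: ifP => [_ /phiS//|]; rewrite eqxx.
- exists [seq push e y | y <- S] => x.
  case px: (pop x) => [[f y]|]; last by rewrite eqxx.
  case: (f =P e) => [fe|]; rewrite ?eqxx // => /phiS yS.
  by have [_ _ <-] := popE px; rewrite fe map_f.
- exists (pmap (fun x => omap snd (pop x)) S) => x.
  case: (base x =P range e) => [xe|]; rewrite ?eqxx // => /phiS xS.
  by rewrite mem_pmap; apply/mapP; exists (push e x); rewrite ?pop_push.
- by exists [::] => y; rewrite eqxx.
- have [S1 S1P] := IHs _ _ phiS; have [S2 S2P] := IHt _ _ phiS.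
  exists (S1 ++ S2) => y; rewrite mem_cat.
  have [->|/S1P ->//] := eqVneq (act s phi y) 0; rewrite add0r => /S2P ->.
  by rewrite orbT.
- have [S1 S1P] := IHt _ _ phiS; exists S1 => y.
  by rewrite mulf_eq0 => /norP[_ /S1P].
- by have [S1 S1P] := IHt _ _ phiS; apply: IHs S1P.
Qed.

Lemma delta_finite x y : delta x y != 0 -> y \in [:: x].
Proof. by rewrite /delta inE; case: ifP => //; rewrite eqxx. Qed.

Lemma act_delta_finite t x :
  exists2 S : seq X, uniq S & forall y, act t (delta x) y != 0 -> y \in S.
Proof.
have [S SP] := act_finite t (@delta_finite x).
by exists (undup S) => [|y /SP]; rewrite ?undup_uniq ?mem_undup.
Qed.

(** Matrix multiplication: [act s (delta y) z] is the entry of [s] in row [z] and column [y]. *)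
Lemma act_mul_delta s t x z (S : seq X) : uniq S ->
    (forall y, act t (delta x) y != 0 -> y \in S) ->
  act (TMul s t) (delta x) z
  = \sum_(y <- S) act t (delta x) y * act s (delta y) z.
Proof.
move=> uS tS; rewrite /= [in LHS](fun_delta uS tS) act_sum.
by apply: eq_bigr => y _; exact: actZ.
Qed.

(** * Adjoints and positivity *)

Section Adjoint.
Variable conj : K -> K.
Hypothesis conj_inv : is_involution *%R conj.

Lemma conjM a b : conj (a * b) = conj a * conj b.
Proof. by case: conj_inv => _ -> _; rewrite mulrC. Qed.

Lemma conj0 : conj 0 = 0.
Proof.
by case: conj_inv => cD _ _; apply: (addIr (conj 0)); rewrite -cD !add0r.
Qed.

Lemma conj1 : conj 1 = 1.
Proof.
case: conj_inv => _ _ cK.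
by have := conjM (conj 1) 1; rewrite mulr1 cK mul1r.
Qed.

(** Either entry is 1 exactly when [y] lies over [range e] and [push e y = x], and 0 otherwise. *)
Lemma act_ghost_delta e x y :
  act (TGhost K e) (delta x) y = act (TEdge K e) (delta y) x.
Proof.
rewrite /= /delta; case px: (pop x) => [[f z]|].
  have [_ zf fz] := popE px.
  have [ye|ye] := eqVneq; last first.
    have [fe|//] := eqVneq; case: eqP => // zy.
    by rewrite -zy zf fe eqxx in ye.
  have [yx|yx] := eqVneq.
    by move: px; rewrite -yx pop_push // => -[-> ->]; rewrite !eqxx.
  have [fe|//] := eqVneq; case: eqP => // zy.
  by rewrite -fz zy fe eqxx in yx.
by case: eqP => // ye; case: eqP => // yx; rewrite -yx pop_push in px.
Qed.

Lemma conj_delta x y : conj (delta x y) = delta x y.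
Proof. by rewrite /delta (fun_if conj) conj0 conj1. Qed.

Lemma deltaC x y : delta x y = delta y x.
Proof. by rewrite /delta eq_sym. Qed.

Lemma conj_act_edge e x y :
  conj (act (TEdge K e) (delta x) y) = act (TEdge K e) (delta x) y.
Proof.
rewrite /=; case: (pop y) => [[f z]|]; last exact: conj0.
by case: ifP => _; rewrite ?conj_delta ?conj0.
Qed.

(** The star becomes the conjugate transpose. Generators have entries 0 and 1, which [conj]
    fixes. *)
Lemma act_star t x y :
  act (term_star conj t) (delta x) y = conj (act t (delta y) x).
Proof.
case: (conj_inv) => cD _ cK.
elim: t x y => [v|e|e||s IHs t IHt|c t IHt|s IHs t IHt] x y.
- rewrite /= (fun_if conj) conj0 conj_delta deltaC /delta.
  by have [->|_] := eqVneq y x; rewrite ?if_same.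
- by rewrite conj_act_edge -act_ghost_delta.
- by rewrite act_ghost_delta conj_act_edge.
- by rewrite /= conj0.
- by rewrite /= IHs IHt cD.
- by rewrite /= IHt conjM.
have [S1 uS1 S1P] := act_delta_finite (term_star conj s) x.
have [S2 uS2 S2P] := act_delta_finite t y.
(* The two matrix products come with different finite supports, so both sums are taken over the
   union. *)
have subl z : z \in S1 -> z \in undup (S1 ++ S2).
  by rewrite mem_undup mem_cat => ->.
have subr z : z \in S2 -> z \in undup (S1 ++ S2).
  by rewrite mem_undup mem_cat orbC => ->.
rewrite [term_star _ _]/= (act_mul_delta _ _ (undup_uniq (S1 ++ S2)));
  last by move=> z /S1P; apply: subl.
rewrite (act_mul_delta _ _ (undup_uniq (S1 ++ S2)));
  last by move=> z /S2P; apply: subr.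
rewrite (big_morph _ cD conj0); apply: eq_bigr => z _.
by rewrite IHs IHt conjM mulrC.
Qed.

(** The empty list is set apart because positive definiteness concerns positive [n] only. *)
Lemma positive_definite_seq (I : Type) (r : seq I) (F : I -> K) :
  positive_definite *%R conj ->
  \sum_(i <- r) conj (F i) * F i = 0 -> all (fun i => F i == 0) r.
Proof.
case: r => // i0 r pd; rewrite (big_nth i0) big_mkord.
move/(pd (size (i0 :: r)) isT (fun i => F (nth i0 (i0 :: r) i))) => Fr.
by apply/(all_nthP i0) => i lt_i; have /= -> := Fr (Ordinal lt_i).
Qed.

Lemma rep_star (a : lpa K E) x y :
  rep (lpa_star conj a) (delta x) y = conj (rep a (delta y) x).
Proof.
by elim/lpa_ind: a => t; rewrite lpa_star_class // !rep_class act_star.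
Qed.

(* The coefficient of sum_i a_i^* a_i at (x, x) is sum_(i, y) of
   conj (a_i)_(y, x) * (a_i)_(y, x). *)
Lemma rep_positive (n : nat) (a : 'I_n -> lpa K E) :
    positive_definite *%R conj ->
    \sum_(i < n) lpa_mul (lpa_star conj (a i)) (a i) = 0 ->
  forall i x y, rep (a i) (delta x) y = 0.
Proof.
move=> pd a0 i x y.
have /choice[S SP] (j : 'I_n) : exists S : seq X,
    uniq S /\ forall y, rep (a j) (delta x) y != 0 -> y \in S.
  by have [S] := act_delta_finite (repr (a j)) x; exists S.
(* Flattening the double sum lets positive definiteness apply once to all entries of the columns at
   [x]. *)
have : \sum_(p <- [seq (j, z) | j <- index_enum 'I_n, z <- S j])
    conj (rep (a p.1) (delta x) p.2) * rep (a p.1) (delta x) p.2 = 0.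
  rewrite big_allpairs_dep -[RHS](rep0 (delta x) x) -a0 rep_sum.
  apply: eq_bigr => j _; have [uS aS] := SP j.
  rewrite repM [in RHS](fun_delta uS aS) /rep act_sum; apply: eq_bigr => z _.
  by rewrite actZ mulrC -[act (repr (lpa_star _ _)) _ _]/(rep _ _ _) rep_star.
move/(positive_definite_seq pd) /allP => all0.
apply/eqP/negP => /negP ay; case/negP: (ay).
apply: (all0 (i, y)); apply/allpairsPdep; exists i, y; split=> //.
  exact: mem_index_enum.
by apply: (SP i).2.
Qed.

End Adjoint.

End Representation.

(** * Monomials *)

Section Monomials.
Variables (K : fieldType) (E : graph).
Notation "a ** b" := (lpa_mul a b) (at level 40, left associativity).
Implicit Types (a b : lpa K E) (e f : edge E) (p q : seq (edge E))
  (v w : vertex E).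

Lemma lpa_mul0r a : lpa_mul 0 a = 0.
Proof. by apply: (addrI (0 ** a)); rewrite -lpa_mulDl !addr0. Qed.

Lemma lpa_mulr0 a : a ** 0 = 0.
Proof. by apply: (addrI (a ** 0)); rewrite -lpa_mulDr !addr0. Qed.

Lemma lpa_mul_sumr (I : Type) (r : seq I) (F : I -> lpa K E) a :
  a ** (\sum_(i <- r) F i) = \sum_(i <- r) a ** F i.
Proof. by apply: (big_morph _ (lpa_mulDr a) (lpa_mulr0 a)). Qed.

Lemma lpa_mul_suml (I : Type) (r : seq I) (F : I -> lpa K E) a :
  (\sum_(i <- r) F i) ** a = \sum_(i <- r) F i ** a.
Proof.
apply: (big_morph (fun b => b ** a)); last exact: lpa_mul0r.
by move=> b c; apply: lpa_mulDl.
Qed.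

Lemma vertex_vertex v w :
  lpa_vertex K v ** lpa_vertex K w = if v == w then lpa_vertex K w else 0.
Proof.
rewrite -lpa_classM; case: eqP => [->|vw].
  exact/lpa_classP/cong_V_same.
exact/lpa_classP/cong_V_diff.
Qed.

Lemma source_edge e : lpa_vertex K (source e) ** lpa_edge K e = lpa_edge K e.
Proof. rewrite -lpa_classM; exact/lpa_classP/cong_P1_source. Qed.

Lemma edge_range e : lpa_edge K e ** lpa_vertex K (range e) = lpa_edge K e.
Proof. rewrite -lpa_classM; exact/lpa_classP/cong_P1_range. Qed.

Lemma range_ghost e : lpa_vertex K (range e) ** lpa_ghost K e = lpa_ghost K e.
Proof. rewrite -lpa_classM; exact/lpa_classP/cong_P2_range. Qed.

Lemma ghost_source e : lpa_ghost K e ** lpa_vertex K (source e) = lpa_ghost K e.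
Proof. rewrite -lpa_classM; exact/lpa_classP/cong_P2_source. Qed.

Lemma ghost_edge e f :
  lpa_ghost K e ** lpa_edge K f = if e == f then lpa_vertex K (range f) else 0.
Proof.
rewrite -lpa_classM; case: eqP => [->|ef].
  exact/lpa_classP/cong_CK1_same.
exact/lpa_classP/cong_CK1_diff.
Qed.

Lemma regular_vertex_sum v (es : seq (edge E)) :
    uniq es -> es != [::] -> (forall e, e \in es = (source e == v)) ->
  lpa_vertex K v = \sum_(e <- es) lpa_edge K e ** lpa_ghost K e.
Proof.
move=> ues es0 esP; have [nsink ninf] : regular v by apply/regularP; exists es.
transitivity (lpa_class (tsum [seq TMul (TEdge K e) (TGhost K e) | e <- es])).
  apply/lpa_classP/cong_CK2 => //; first exact/NoDup_uniq.
  by move=> e; rewrite In_mem esP; split=> /eqP.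
elim: (es) => [|e s IHs]; first by rewrite big_nil.
by rewrite big_cons /= lpa_classD lpa_classM IHs.
Qed.

(* A path is given by its edges together with its range, so that the empty
   list of edges stands for a vertex. *)
Definition path_source p w : vertex E := if p is e :: _ then source e else w.

Fixpoint valid_path p w : bool :=
  if p is e :: p' then (range e == path_source p' w) && valid_path p' w
  else true.

Definition real_path p w : lpa K E :=
  foldr (fun e a => lpa_edge K e ** a) (lpa_vertex K w) p.

Definition ghost_path p w : lpa K E :=
  foldr (fun e a => a ** lpa_ghost K e) (lpa_vertex K w) p.

Definition mono : Type := (seq (edge E) * seq (edge E) * vertex E)%type.

Definition monomial (m : mono) : lpa K E :=
  real_path m.1.1 m.2 ** ghost_path m.1.2 m.2.

Lemma vertex_real_path v p w : lpa_vertex K v ** real_path p w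
  = if v == path_source p w then real_path p w else 0.
Proof.
case: p => [|e p] /=; first by rewrite vertex_vertex.
rewrite -source_edge !lpa_mulA vertex_vertex.
by case: ifP => // _; rewrite !lpa_mul0r.
Qed.

Lemma ghost_path_vertex v p w : ghost_path p w ** lpa_vertex K v
  = if v == path_source p w then ghost_path p w else 0.
Proof.
case: p => [|e p] /=.
  by rewrite vertex_vertex eq_sym; case: eqP => // ->.
rewrite -ghost_source -!lpa_mulA vertex_vertex eq_sym.
by case: eqP => [->|_] //; rewrite !lpa_mulr0.
Qed.

(** The end of the fold is arbitrary, so that absorbing the range vertex and appending an edge are
    both instances. *)
Lemma foldr_edge a b p : foldr (fun e c => lpa_edge K e ** c) (a ** b) p
  = foldr (fun e c => lpa_edge K e ** c) a p ** b.
Proof. by elim: p => //= e p ->; rewrite lpa_mulA. Qed.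

Lemma foldr_ghost a b p : foldr (fun e c => c ** lpa_ghost K e) (a ** b) p
  = a ** foldr (fun e c => c ** lpa_ghost K e) b p.
Proof. by elim: p => //= e p ->; rewrite lpa_mulA. Qed.

Lemma real_path_range p w : real_path p w ** lpa_vertex K w = real_path p w.
Proof. by rewrite -foldr_edge vertex_vertex eqxx. Qed.

Lemma range_ghost_path p w : lpa_vertex K w ** ghost_path p w = ghost_path p w.
Proof. by rewrite -foldr_ghost vertex_vertex eqxx. Qed.

Lemma real_path_rcons p e :
  real_path (rcons p e) (range e) = real_path p (source e) ** lpa_edge K e.
Proof.
by rewrite /real_path foldr_rcons edge_range -foldr_edge source_edge.
Qed.

Lemma ghost_path_rcons p e :
  ghost_path (rcons p e) (range e) = lpa_ghost K e ** ghost_path p (source e).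
Proof.
by rewrite /ghost_path foldr_rcons range_ghost -foldr_ghost ghost_source.
Qed.

(** Inserting [range e] at a break produces a product of two distinct vertices. Monomials can thus
    be formed from arbitrary lists. *)
Lemma real_path_invalid p w : ~~ valid_path p w -> real_path p w = 0.
Proof.
elim: p => //= e p IHp; rewrite negb_and => /orP[ep|/IHp->]; last first.
  exact: lpa_mulr0.
by rewrite -edge_range -lpa_mulA vertex_real_path (negPf ep) lpa_mulr0.
Qed.

Lemma ghost_path_invalid p w : ~~ valid_path p w -> ghost_path p w = 0.
Proof.
elim: p => //= e p IHp; rewrite negb_and => /orP[ep|/IHp->]; last first.
  exact: lpa_mul0r.
by rewrite -range_ghost lpa_mulA ghost_path_vertex (negPf ep) lpa_mul0r.
Qed.

(** (CK2) is inserted at [w], between the real and the ghost part. *)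
Lemma monomial_split p q w (es : seq (edge E)) :
    uniq es -> es != [::] -> (forall e, e \in es = (source e == w)) ->
  monomial (p, q, w)
  = \sum_(e <- es) monomial (rcons p e, rcons q e, range e).
Proof.
move=> ues es0 esP; rewrite /monomial /= -[real_path p w]real_path_range.
rewrite (regular_vertex_sum ues es0 esP) lpa_mul_sumr lpa_mul_suml.
apply: eq_big_seq => e; rewrite esP => /eqP <-.
by rewrite real_path_rcons ghost_path_rcons !lpa_mulA.
Qed.

(** * Spanning by reduced monomials *)

Definition spanned (P : mono -> Prop) a : Prop :=
  exists r : seq (K * mono), (forall c, c \in r -> P c.2) /\
    a = \sum_(c <- r) c.1 *: monomial c.2.

Lemma spanned0 P : spanned P 0.
Proof. by exists [::]; rewrite big_nil. Qed.

Lemma spannedD P a b : spanned P a -> spanned P b -> spanned P (a + b).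
Proof.
move=> [r [rP ->]] [r' [r'P ->]]; exists (r ++ r'); rewrite big_cat; split=> //.
by move=> c; rewrite mem_cat => /orP[/rP|/r'P].
Qed.

Lemma spannedZ P k a : spanned P a -> spanned P (k *: a).
Proof.
move=> [r [rP ->]]; exists [seq (k * c.1, c.2) | c <- r]; split.
  by move=> _ /mapP[c /rP ? ->].
by rewrite big_map scaler_sumr; apply: eq_bigr => c _; rewrite scalerA.
Qed.

Lemma spanned_monomial (P : mono -> Prop) m : P m -> spanned P (monomial m).
Proof.
move=> Pm; exists [:: (1, m)]; rewrite big_seq1 scale1r; split=> //.
by move=> c; rewrite inE => /eqP->.
Qed.

Lemma spanned_sum (I : eqType) P (r : seq I) (F : I -> lpa K E) :
  (forall i, i \in r -> spanned P (F i)) -> spanned P (\sum_(i <- r) F i).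
Proof.
move=> rP; rewrite big_seq; elim/big_ind: _ => //; first exact: spanned0.
exact: spannedD.
Qed.

Notation spannedT := (spanned (fun=> True)).

Lemma vertex_monomial v m : spannedT (lpa_vertex K v ** monomial m).
Proof.
rewrite /monomial lpa_mulA vertex_real_path; case: ifP => _.
  exact: spanned_monomial.
by rewrite lpa_mul0r; apply: spanned0.
Qed.

Lemma edge_monomial e m : spannedT (lpa_edge K e ** monomial m).
Proof.
case: m => [[p q] w]; rewrite /monomial lpa_mulA.
exact: (@spanned_monomial (fun=> True) (e :: p, q, w)).
Qed.

Lemma ghost_monomial e m : spannedT (lpa_ghost K e ** monomial m).
Proof.
(* If the real part is empty, the ghost edge extends the ghost path or gives 0 for lack of a common
   vertex; otherwise (CK1) cancels [f] or gives 0. *)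
case: m => [[[|f p] q] w]; rewrite /monomial /=.
  rewrite range_ghost_path -ghost_source -range_ghost_path !lpa_mulA.
  rewrite -[_ ** lpa_vertex K w]lpa_mulA vertex_vertex.
  case: eqP => [<-|_]; last by rewrite lpa_mulr0 lpa_mul0r; apply: spanned0.
  rewrite ghost_source -ghost_path_rcons -range_ghost_path.
  exact: (@spanned_monomial (fun=> True) ([::], rcons q e, range e)).
rewrite !lpa_mulA ghost_edge; case: ifP => _; last first.
  by rewrite !lpa_mul0r; apply: spanned0.
by rewrite -lpa_mulA; apply: (vertex_monomial _ (p, q, w)).
Qed.

Lemma spanned_mul t a : spannedT a -> spannedT (lpa_class t ** a).
Proof.
elim: t a => [v|e|e||s IHs t IHt|k t IHt|s IHs t IHt] a aT.
1-3: case: aT => r [_ ->]; rewrite lpa_mul_sumr; apply: spanned_sum => c _;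
     rewrite lpa_scalerAr; apply: spannedZ.
- exact: vertex_monomial.
- exact: edge_monomial.
- exact: ghost_monomial.
- by rewrite lpa_class0 lpa_mul0r; apply: spanned0.
- by rewrite lpa_classD lpa_mulDl; apply: spannedD; [apply: IHs|apply: IHt].
- by rewrite lpa_classZ lpa_scalerAl; apply/spannedZ/IHt.
- by rewrite lpa_classM -lpa_mulA; apply/IHs/IHt.
Qed.

(** The span is stable under left multiplication and contains the vertices; edges and ghosts follow
    by writing them as themselves times a vertex. *)
Lemma spanned_all a : spannedT a.
Proof.
have vT v : spannedT (lpa_vertex K v).
  rewrite -[lpa_vertex K v](_ : monomial ([::], [::], v) = _).
    exact: spanned_monomial.
  by rewrite /monomial /= vertex_vertex eqxx.
elim/lpa_ind: a; elim=> [//|e|e||s IHs t IHt|k t IHt|s IHs t IHt].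
- by rewrite -[lpa_class _]edge_range; apply: spanned_mul.
- by rewrite -[lpa_class _]ghost_source; apply: spanned_mul.
- exact: spanned0.
- by rewrite lpa_classD; apply: spannedD.
- by rewrite lpa_classZ; apply: spannedZ.
- by rewrite lpa_classM; apply: spanned_mul.
Qed.

(* Distinct reduced monomials are linearly independent, in contrast with
   monomials in general, which are related by (CK2). *)
Definition reduced (N : nat) (m : mono) : Prop :=
  [/\ valid_path m.1.1 m.2, valid_path m.1.2 m.2, (size m.1.2 <= N)%N
    & (size m.1.2 < N)%N -> ~ regular m.2].

(** As long as the ghost part is shorter than [N] and [w] is regular, (CK2) lengthens it by one
    edge. The induction is on a bound for the missing length. *)
Lemma spanned_reduced N m :
  (size m.1.2 <= N)%N -> spanned (reduced N) (monomial m).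
Proof.
move: {2}(N - size m.1.2)%N (leqnn (N - size m.1.2)) => k.
elim: k m => [|k IHk] [[p q] w] /= le_k le_N;
  (have [pw|/real_path_invalid p0] := boolP (valid_path p w);
   last by rewrite /monomial p0 lpa_mul0r; apply: spanned0);
  (have [qw|/ghost_path_invalid q0] := boolP (valid_path q w);
   last by rewrite /monomial q0 lpa_mulr0; apply: spanned0).
  apply: spanned_monomial; split=> //= lt_N.
  by move: le_k; rewrite leqn0 subn_eq0 leqNgt lt_N.
have [[ge_N|/regularP[es [ues es0 esP]]]|] :=
    pselect ((N <= size q)%N \/ regular w).
- apply: spanned_monomial; split=> //= lt_N.
  by rewrite leqNgt lt_N in ge_N.
- have [lt_N|ge_N] := ltnP (size q) N; last first.
    by apply: spanned_monomial; split=> //= lt_N; rewrite ltnNge ge_N in lt_N.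
  rewrite (monomial_split _ _ ues es0 esP); apply: spanned_sum => e _.
  apply: IHk; rewrite /= size_rcons //.
  by rewrite subnS -subn1 leq_subLR add1n.
- move=> not; apply: spanned_monomial; split=> //= _ rw.
  by apply: not; right.
Qed.

Lemma reduced_span a : exists N, spanned (reduced N) a.
Proof.
have [r [_ ->]] := spanned_all a.
exists (\max_(c <- r) size c.2.1.2)%N; apply: spanned_sum => c cr.
apply/spannedZ/spanned_reduced.
exact: (@leq_bigmax_seq _ r predT (fun c => size c.2.1.2)%N).
Qed.

(** Since [spanned] allows repetitions, equal monomials are merged to give each a single
    coefficient. *)
Lemma sum_group (V : lmodType K) (I : eqType) (r : seq (K * I)) (F : I -> V) :
  \sum_(c <- r) c.1 *: F c.2
  = \sum_(i <- undup [seq c.2 | c <- r]) (\sum_(c <- r | c.2 == i) c.1) *: F i.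
Proof.
under [RHS]eq_bigr do rewrite scaler_suml big_mkcond.
rewrite exchange_big; apply: eq_big_seq => c cr /=.
rewrite (bigD1_seq c.2) ?undup_uniq ?mem_undup ?map_f //= eqxx.
by rewrite big1 ?addr0 // => i; rewrite eq_sym => /negPf ->.
Qed.

(** * Faithfulness of the action *)

Section Faithful.
Variable B : branching E.
Implicit Types x y z : point B.

Definition push_path p z : point B := foldr (@push E B) z p.

Lemma rep_vertex v phi x :
  rep (lpa_vertex K v) phi x = if base x == v then phi x else 0.
Proof. by rewrite rep_class. Qed.

Lemma rep_ghost e phi x : rep (lpa_ghost K e) phi x
  = if base x == range e then phi (push e x) else 0.
Proof. by rewrite rep_class. Qed.

Lemma rep_edge e phi x : rep (lpa_edge K e) phi x
  = if pop x is Some (f, y) then if f == e then phi y else 0 else 0.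
Proof. by rewrite rep_class. Qed.

Lemma base_push_path p w z :
  valid_path p w -> base z = w -> base (push_path p z) = path_source p w.
Proof.
elim: p => //= e p IHp /andP[/eqP ep pw] zw.
by rewrite base_push // IHp.
Qed.

Lemma pop_push_path e p w z : valid_path (e :: p) w -> base z = w ->
  pop (push_path (e :: p) z) = Some (e, push_path p z).
Proof.
by move=> /= /andP[/eqP ep pw] zw; rewrite pop_push // (base_push_path pw).
Qed.

Lemma degree_push_path p z : degree (push_path p z) = degree z + (size p)%:Z.
Proof.
elim: p => [|e p IHp] /=; first by rewrite addr0.
by rewrite degree_push IHp -addrA -addn1 PoszD.
Qed.

(** Popping the common point reads off both paths edge by edge. When [p0] is exhausted, so is [p],
    either because [z0] cannot be popped or because the lengths agree. *)
Lemma push_path_inj p p0 w w0 z z0 :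
    valid_path p w -> valid_path p0 w0 -> base z = w -> base z0 = w0 ->
    (size p0 <= size p)%N -> pop z0 = None \/ size p = size p0 ->
    push_path p z = push_path p0 z0 ->
  p = p0 /\ z = z0.
Proof.
move=> + + zw z0w0; elim: p0 p => [|e0 p0 IHp] [|e p] //.
  by move=> v _ _ [] // z0N /= pz; rewrite -pz (pop_push_path v zw) in z0N.
move=> v v0 le_p cond pz; have := pop_push_path v zw.
rewrite pz (pop_push_path v0 z0w0) => -[<- pz'].
move: v v0 => /= /andP[_ v] /andP[_ v0].
have [] // := IHp p v v0 le_p _ (esym pz'); last by move=> -> ->.
by case: cond => [|[]]; [left | right].
Qed.

Lemma rep_real_path p w phi z : valid_path p w -> base z = w ->
  rep (real_path p w) phi (push_path p z) = phi z.
Proof.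
move=> + zw; elim: p => [_|e p IHp v] /=.
  by rewrite rep_vertex zw eqxx.
rewrite repM rep_edge (pop_push_path v zw) eqxx IHp //.
by case/andP: v.
Qed.

Lemma rep_real_path_neq0 p w phi y : rep (real_path p w) phi y != 0 ->
  exists z, [/\ base z = w, y = push_path p z & phi z != 0].
Proof.
elim: p y => [|e p IHp] y /=.
  rewrite rep_vertex; case: (base y =P w) => [yw phiy|]; last by rewrite eqxx.
  by exists y.
rewrite repM rep_edge; case py: (pop y) => [[f x]|]; last by rewrite eqxx.
case: (f =P e) => [fe|]; last by rewrite eqxx.
case/IHp => z [zw xz phiz]; exists z; split=> //.
by have [_ _ <-] := popE py; rewrite fe xz.
Qed.

Lemma rep_ghost_path p w phi z : valid_path p w -> base z = w ->
  rep (ghost_path p w) phi z = phi (push_path p z).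
Proof.
move=> + zw; elim: p phi => [|e p IHp] phi /=.
  by rewrite rep_vertex zw eqxx.
move=> /andP[/eqP ep v]; rewrite repM IHp // rep_ghost.
by rewrite (base_push_path v zw) ep eqxx.
Qed.

Lemma rep_monomial p q w z :
    valid_path p w -> valid_path q w -> base z = w ->
  rep (monomial (p, q, w)) (delta K (push_path q z)) (push_path p z) = 1.
Proof.
move=> pw qw zw; rewrite repM /= rep_real_path // rep_ghost_path //.
by rewrite /delta eqxx.
Qed.

Lemma rep_monomial_neq0 p q w x y : valid_path q w ->
    rep (monomial (p, q, w)) (delta K x) y != 0 ->
  exists z, [/\ base z = w, y = push_path p z & x = push_path q z].
Proof.
move=> qw; rewrite repM /= => /rep_real_path_neq0[z [zw yz]].
rewrite rep_ghost_path // => /delta_finite; rewrite inE => /eqP xz.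
by exists z.
Qed.

(* A reduced monomial p q^* with |q| minimal is detected by the matrix
   coefficient at (q z, p z), where z is a point over the range of q outside
   the images of all edges if this range is singular: any other p' q'^*
   contributing there has q' = q, and then p' = p because |p'| = |p|. *)
Lemma rep_faithful a : (forall x y, rep a (delta K x) y = 0) -> a = 0.
Proof.
have [N [r [rN ->]]] := reduced_span a; rewrite sum_group.
set ms := undup _; pose k m := \sum_(c <- r | c.2 == m) c.1 => a0.
have {}a0 x y : \sum_(m <- ms) k m * rep (monomial m) (delta K x) y = 0.
  by rewrite -[RHS](a0 x y) rep_sum; apply: eq_bigr => m _; rewrite repZ.
have ms_uniq : uniq ms by apply: undup_uniq.
have msN m : m \in ms -> reduced N m.
  by rewrite mem_undup => /mapP[c cr ->]; apply: rN.
(* Minimality of the ghost length becomes an induction on a strict bound [n] for it. *)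
suff k0 n m : m \in ms -> (size m.1.2 < n)%N -> k m = 0.
  by rewrite big1_seq // => m /= /k0 km;
     rewrite -[X in X *: _]/(k m) (km _ (leqnn _)) scale0r.
elim: n m => // n IHn [[p0 q0] w0] m0ms; rewrite ltnS => le_n.
have [/= p0w0 q0w0 q0N singular_w0] := msN _ m0ms.
have [z0 z0w0 z0N] :
    exists2 z0, base z0 = w0 &
    (size q0 < N)%N -> pop z0 = None :> option (_ * point B).
  have [lt_N|ge_N] := ltnP (size q0) N.
    by have [z ? ?] := point_singular B (singular_w0 lt_N); exists z.
  by have [z ?] := point_over B w0; exists z.
have := a0 (push_path q0 z0) (push_path p0 z0).
rewrite (bigD1_seq _ m0ms ms_uniq) rep_monomial // mulr1.
rewrite big1_seq /= ?addr0 // => -[[p q] w] /andP[/eqP mm0 mms].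
have [/= pw qw qN _] := msN _ mms.
apply/eqP; rewrite mulf_eq0; apply/norP => -[km].
case/(rep_monomial_neq0 qw) => z [zw eqp eqq]; apply: mm0.
have le_q : (size q0 <= size q)%N.
  rewrite leqNgt; apply: contra km => lt_q; apply/eqP/IHn => //=.
  exact: leq_trans lt_q le_n.
(* Either [z0] cannot be popped, or [q0] has the full length [N], which also bounds [q]. *)
have cond : pop z0 = None \/ size q = size q0.
  have [/z0N|ge_N] := ltnP (size q0) N; [by left | right].
  by apply/eqP; rewrite eqn_leq le_q (leq_trans qN ge_N).
have [-> ez] := push_path_inj qw q0w0 zw z0w0 le_q cond (esym eqq).
have ew : w = w0 by rewrite -zw ez.
(* Degrees count edges. Without them, a cycle without exit could fix the point and lengthen [p]
   unnoticed. *)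
have sizep : size p = size p0.
  have := congr1 (@degree E B) eqp; rewrite !degree_push_path ez.
  by move/addrI => -[].
have [|-> _] := push_path_inj pw p0w0 zw z0w0 _ (or_intror sizep) (esym eqp).
  by rewrite sizep.
by rewrite ew.
Qed.

End Faithful.

End Monomials.

(** * Transfer of positive definiteness between the field and the algebra *)

Lemma lpa_positive_definite (K : fieldType) (conj : K -> K) (E : graph) :
    is_involution *%R conj -> positive_definite *%R conj ->
  positive_definite (@lpa_mul K E) (@lpa_star K E conj).
Proof.
move=> conj_inv pd n _ a a0 i; have [B] := branching_exists E.
by apply: (@rep_faithful K E B) => x y; apply: (rep_positive conj_inv pd a0).
Qed.

Lemma field_positive_definite (K : fieldType) (conj : K -> K) (E : graph) :
    is_involution *%R conj -> inhabited (vertex E) ->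
    positive_definite (@lpa_mul K E) (@lpa_star K E conj) ->
  positive_definite *%R conj.
Proof.
move=> conj_inv [v] pd n n_gt0 k k0 i; have [B] := branching_exists E.
have starE (c : K) :
    lpa_star conj (c *: lpa_vertex K v) = conj c *: lpa_vertex K v.
  by rewrite -lpa_classZ lpa_star_class // -lpa_classZ.
have /pd/(_ i) kv : \sum_(i < n) lpa_mul
    (lpa_star conj (k i *: lpa_vertex K v)) (k i *: lpa_vertex K v) = 0.
  transitivity ((\sum_(i < n) conj (k i) * k i) *: lpa_vertex K v).
    rewrite scaler_suml; apply: eq_bigr => j _.
    rewrite starE lpa_scalerAl lpa_scalerAr vertex_vertex eqxx.
    by rewrite scalerA.
  by rewrite k0 scale0r.
(* The vertex [v] fixes the point mass at a point over it, so the scalar [k i] can be read off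
   there. *)
have [x xv] := point_over B v.
have := repZ (k i) (lpa_vertex K v) (delta K x) x.
by rewrite kv // rep0 rep_vertex xv eqxx /delta eqxx mulr1.
Qed.

Theorem proposition2p4 (K : fieldType) (conj : K -> K)
    (conj_inv : is_involution *%R conj) :
  (positive_definite *%R conj <->
     forall E : graph, positive_definite (@lpa_mul K E) (@lpa_star K E conj))
  (* the graph without vertices, whose algebra is 0, is excluded below *)
  /\ ((forall E : graph, positive_definite (@lpa_mul K E) (@lpa_star K E conj))
      <-> exists E : graph, inhabited (vertex E) /\
            positive_definite (@lpa_mul K E) (@lpa_star K E conj))
  /\ (forall E : graph, inhabited (vertex E) ->
        (positive_definite (@lpa_mul K E) (@lpa_star K E conj) <->
         positive_definite *%R conj)).
Proof.
have up E := @lpa_positive_definite K conj E conj_inv.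
have down E := @field_positive_definite K conj E conj_inv.
pose pt : graph := @Graph unit void (fun=> tt) (fun=> tt).
have pt_inh : inhabited (vertex pt) by exists; exact: tt.
split; [|split].
- by split=> [pd E|pd]; [apply: up | apply: (down pt)].
- split=> [pd|[E [E_inh pd]] F]; first by exists pt.
  exact/up/(down E).
- by move=> E E_inh; split; [apply: down | apply: up].
Qed.
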